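(* Let $X$ be a Banach space of type $p$, $1<p\le 2$, with type constant $T_p(X)$, let $w=\frac{1-p}{p}$, and set $C(X)=2^{1/p}\,T_p(X)$. Let $S$ be a set of $n\ge2$ pairwise different points in $X$. Then there is a partition of $S$ into two sets $S_1,S_2$ of sizes $\lfloor\frac n2\rfloor$ and $\lceil\frac n2\rceil$, respectively, such that $$\left\|c(S_1)-c(S_2)\right\|\le C(X)\left\lceil\frac n2\right\rceil^{w}\operatorname{diam} S.$$
   Context: For a finite nonempty set $S$ in a linear space, $c(S)=\frac1{|S|}\sum_{s\in S}s$ denotes its centroid. A Banach space $X$ is of type $p$, for some $1<p\le 2$, if there is a constant $T_p(X)<\infty$ such that for every finite sequence of vectors $x_1,\dots,x_n\in X$, $$\int_0^1\Big\|\sum_{j=1}^n R_j(t)x_j\Big\|\,dt\le T_p(X)\Big(\sum_{j=1}^n\|x_j\|^p\Big)^{1/p},$$ where $\{R_j\}_{j\ge1}$ are the Rademacher functions. Thus the left-hand side is the average of $\|\sum_j \varepsilon_j x_j\|$ over all $2^n$ choices of signs $\varepsilon_j=\pm1$. $T_p(X)$ denotes the constant in this definition. *)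

(* Defs.v *)
From HB Require Import structures.
From mathcomp Require Import all_boot all_order all_algebra finmap.
From mathcomp Require Import all_classical all_reals all_analysis.
Import Order.TTheory GRing.Theory Num.Theory numFieldNormedType.Exports.

Set Implicit Arguments.
Unset Strict Implicit.
Unset Printing Implicit Defensive.

Local Open Scope classical_set_scope.
Local Open Scope ring_scope.

(* The j-th Rademacher function (j >= 1) on [0, 1]: its value is (-1) to the
   j-th binary digit of t, so it is constant and equal to +1 or -1 on each
   dyadic interval [k / 2 ^ j, (k + 1) / 2 ^ j[, with alternating signs.
   It equals sgn (sin (2 ^ j * pi * t)) except at finitely many points. *)
Definition rademacher (R : realType) (j : nat) (t : R) : R :=
  (-1) ^ Num.floor (2 ^+ j * t).

(* T is an admissible constant T_p(X) in the definition of type p.  The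
   ordinals of 'I_n start at 0, whence the index j.+1. *)
Definition type_constant (R : realType) (X : normedModType R) (p T : R) :=
  forall (n : nat) (x : 'I_n -> X),
    (\int[@lebesgue_measure R]_(t in `[0%R, 1%R])
        `| \sum_(j < n) rademacher j.+1 t *: x j |%:E
     <= (T * (\sum_(j < n) `|x j| `^ p) `^ p^-1)%:E)%E.

Definition centroid (R : realType) (X : normedModType R) (S : {fset X}) : X :=
  (#|` S|%:R : R)^-1 *: \sum_(s <- S) s.

(* The set of distances is finite, so this supremum is meaningful (a maximum)
   as soon as S is nonempty. *)
Definition diam (R : realType) (X : normedModType R) (S : {fset X}) : R :=
  sup [set d : R | exists x y, [/\ x \in S, y \in S & d = `|x - y|]].

(* Main.v *)
Require Import Defs.
From HB Require Import structures.
From mathcomp Require Import all_boot all_order all_algebra finmap.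
From mathcomp Require Import all_classical all_reals all_analysis.
From mathcomp Require Import ring lra zify.
Import Order.TTheory GRing.Theory Num.Theory numFieldNormedType.Exports.

(** Group the points into pairs [(f i, g i)], with one point [s] left over when
    [n = 2 k + 1]. Distributing each pair between the two parts according to
    signs [e i], the difference of centroids is a multiple of
    [Q + \sum_i e i (2 k + 1) (f i - g i)], where
    [Q = \sum_i (f i - s + (g i - s))]. Applying the type inequality to these
    [k + 1] vectors, and negating all signs if [Q] gets the sign [-1], yields
    suitable signs. For even [n] the vector [Q] is absent. *)

Set Implicit Arguments.
Unset Strict Implicit.
Unset Printing Implicit Defensive.

Local Open Scope ring_scope.

(** * Signs extracted from the type inequality *)

Section Measure.
Import HBNNSimple.

(** The integral of a nonnegative function is the supremum of the integrals of the simple functions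
    below it, and each simple function below [f] is below [g]. Thus the Rademacher integrand can be
    compared with a constant without a measurability proof. *)
Lemma ge0_le_integral_nonmeasurable d (T : measurableType d) (R : realType)
    (mu : {measure set T -> \bar R}) (D : set T) (f g : T -> \bar R) :
    (forall x, D x -> 0 <= f x)%E -> (forall x, D x -> f x <= g x)%E ->
  (\int[mu]_(x in D) f x <= \int[mu]_(x in D) g x)%E.
Proof.
move=> f0 fg.
have g0 x : D x -> (0 <= g x)%E.
  by move=> Dx; exact: le_trans (f0 _ Dx) (fg _ Dx).
rewrite !ge0_integralE//; apply: ge_ereal_sup => _ [h hf <-].
apply: ereal_sup_ubound; exists h => // x; apply: le_trans (hf x) _.
by rewrite /patch; case: ifPn => // /set_mem; exact: fg.
Qed.

End Measure.

Lemma rademacher_sign (R : realType) (j : nat) (t : R) :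
  exists b : bool, rademacher j t = (-1) ^+ b.
Proof.
rewrite /rademacher; case: (Num.floor _) => m.
  by exists (odd m); rewrite -exprnP signr_odd.
by exists (odd m.+1); rewrite NegzE -exprnN signr_odd -exprVn invrN1.
Qed.

(* The average over signs is only needed as an upper bound for the minimum, so
   the distribution of the Rademacher functions plays no role. *)
Lemma exists_signs_le (R : realType) (X : normedModType R) (p T : R) (n : nat)
    (x : 'I_n -> X) : type_constant X p T ->
  exists b : 'I_n -> bool, `|\sum_(j < n) (-1) ^+ b j *: x j|
    <= T * (\sum_(j < n) `|x j| `^ p) `^ p^-1.
Proof.
move=> /(_ n x) hT.
pose F (b : {ffun 'I_n -> bool}) := `|\sum_(j < n) (-1) ^+ b j *: x j|.
have [b _ bmin] := @arg_minP _ _ _ [ffun=> false] predT F isT.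
exists b; rewrite -lee_fin; apply: le_trans hT.
(* The interval has length 1, so the minimum [F b] equals its own integral. At each [t] the
   Rademacher values are one of the choices of signs, so the integrand is at least [F b]
   pointwise. *)
rewrite [leLHS](_ : _ =
  (\int[@lebesgue_measure R]_(t in `[0%R, 1%R]) (F b)%:E)%E).
  apply: ge0_le_integral_nonmeasurable => t _; rewrite lee_fin ?normr_ge0//.
  have [c hc] := choice (fun j : 'I_n => rademacher_sign j.+1 t).
  rewrite (eq_bigr (fun j => (-1) ^+ [ffun i => c i] j *: x j)) ?bmin//.
  by move=> j _; rewrite hc ffunE.
rewrite integral_cst//= lebesgue_measure_itv/=.
by rewrite lte_fin ltr01 oppr0 adde0 mule1.
Qed.

Lemma exists_signs_le_head (R : realType) (X : normedModType R) (p T : R)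
    (n : nat) (y : X) (x : 'I_n -> X) : type_constant X p T ->
  exists b : 'I_n -> bool, `|y + \sum_(j < n) (-1) ^+ b j *: x j|
    <= T * (`|y| `^ p + \sum_(j < n) `|x j| `^ p) `^ p^-1.
Proof.
move=> hT; pose z (i : 'I_n.+1) := oapp x y (unlift ord0 i).
have z0 : z ord0 = y by rewrite /z unlift_none.
have zS j : z (lift ord0 j) = x j by rewrite /z liftK.
have [b] := exists_signs_le z hT; rewrite !big_ord_recl z0.
under [X in `|_ + X|]eq_bigr do rewrite zS.
under [X in (_ + X) `^ _]eq_bigr do rewrite zS.
(* Multiplying the whole sum by the sign of [y] preserves its norm and turns that sign into +1. *)
move=> hb; exists (fun j => b ord0 (+) b (lift ord0 j)); apply: le_trans hb.
have normE v : `|v| = `|(-1) ^+ b ord0 *: v| by rewrite normrZ normr_sign mul1r.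
rewrite [leRHS]normE scalerDr scalerA -expr2 sqrr_sign scale1r scaler_sumr.
by under [X in _ <= `|_ + X|]eq_bigr do rewrite scalerA -signr_addb.
Qed.

(** For the single vector [x], the type inequality bounds a norm by [T] times a positive number. *)
Lemma type_constant_ge0 (R : realType) (X : normedModType R) (p T : R) (x : X) :
  type_constant X p T -> x != 0 -> 0 <= T.
Proof.
move=> hT x0; have [b] := exists_signs_le_head x (fun _ : 'I_0 => 0) hT.
rewrite !big_ord0 !addr0 => /(le_trans (normr_ge0 _)).
by rewrite pmulr_lge0// !powR_gt0// normr_gt0.
Qed.

(** * Diameter, partitions by swapping pairs, and centroids *)

Lemma norm_sub_le_diam (R : realType) (X : normedModType R) (S : {fset X}) x y :
  x \in S -> y \in S -> `|x - y| <= diam S.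
Proof.
move=> xS yS; apply: ub_le_sup; last by exists x, y.
(* The supremum needs some upper bound; the sum of all pairwise distances is one. *)
exists (\sum_(a <- S) \sum_(b <- S) `|a - b|) => _ [a [b [aS bS ->]]].
rewrite (big_rem a)//= (big_rem b)//= -addrA lerDl.
rewrite addr_ge0// ?sumr_ge0// => c _.
exact: sumr_ge0.
Qed.

Lemma perm_cat_swap (I : Type) (K : eqType) (r : seq I) (f g : I -> K)
    (b : I -> bool) :
  perm_eq ([seq if b i then g i else f i | i <- r]
           ++ [seq if b i then f i else g i | i <- r])
          (map f r ++ map g r).
Proof.
apply/permP => a; rewrite !count_cat.
by elim: r => //= i r ih; case: (b i) => /=; lia.
Qed.

Lemma big_fset_seq (V : nmodType) (K : choiceType) (s : seq K) (F : K -> V) :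
  uniq s -> \sum_(x <- [fset x in s]%fset) F x = \sum_(x <- s) F x.
Proof.
by move=> us; apply: perm_big; apply: uniq_perm => // x; rewrite !inE.
Qed.

Lemma centroid_fset_seq (R : realType) (X : normedModType R) (s : seq X) :
  uniq s -> centroid [fset x in s]%fset = (size s)%:R^-1 *: \sum_(x <- s) x.
Proof.
by move=> us; rewrite /centroid card_fseq undup_id// big_fset_seq.
Qed.

(** Swapping within pairs only permutes the enumeration of [S]. As that is duplicate-free, the two
    resulting lists are duplicate-free and disjoint. The leftover [r] always joins the second
    part. *)
Lemma swap_partition (R : realType) (X : normedModType R) (k : nat)
    (S : {fset X}) (f g : 'I_k -> X) (r : seq X) (b : 'I_k -> bool) :
    perm_eq S ((codom f ++ codom g) ++ r) ->
  exists S1 S2 : {fset X},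
    [/\ (S1 `|` S2)%fset = S, [disjoint S1 & S2]%fset,
        #|` S1| = k, #|` S2| = (k + size r)%N &
        centroid S1 - centroid S2 =
          k%:R^-1 *: (\sum_i if b i then g i else f i)
          - (k + size r)%:R^-1 *:
              ((\sum_i if b i then f i else g i) + \sum_(x <- r) x)].
Proof.
move=> Sfg; pose s1 := [seq if b i then g i else f i | i <- enum 'I_k].
pose s2 := [seq if b i then f i else g i | i <- enum 'I_k] ++ r.
have Ss : perm_eq S (s1 ++ s2).
  by rewrite (perm_trans Sfg)// catA perm_cat2r perm_sym perm_cat_swap.
have := fset_uniq S; rewrite (perm_uniq Ss) cat_uniq => /and3P[u1 s12 u2].
have sz1 : size s1 = k by rewrite size_map size_enum_ord.
have sz2 : size s2 = (k + size r)%N by rewrite size_cat size_map size_enum_ord.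
exists [fset x in s1]%fset, [fset x in s2]%fset; split.
- apply/fsetP => x; rewrite in_fsetU !in_fset -mem_cat.
  by apply/esym; exact: (perm_mem Ss x).
- apply/fdisjointP => x; rewrite !in_fset => xs1; apply: contra s12 => xs2.
  by apply/hasP; exists x.
- by rewrite card_fseq undup_id.
- by rewrite card_fseq undup_id.
- rewrite !centroid_fset_seq// sz1 sz2 big_cat/= !big_map.
  by rewrite [index_enum _]unlock.
Qed.

(** Over the common denominator [2 * a * (a + 1)], the coefficients of [u] and [v] are
    [2 * (a + 1) = 1 + (2 * a + 1)] and [- 2 * a = 1 - (2 * a + 1)]. This separates [u + v], which
    does not depend on the signs, from the signed sum [u - v]. *)
Lemma centroid_sub_odd (R : realType) (X : normedModType R) (a : R)
    (u v s : X) : 0 < a ->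
  a^-1 *: u - (a + 1)^-1 *: (v + s) =
  (2 * a * (a + 1))^-1 *: ((u + v - (2 * a) *: s) + (2 * a + 1) *: (u - v)).
Proof.
move=> a0; set c := (_ * (a + 1))^-1.
transitivity ((c + c * (2 * a + 1)) *: u + (c - c * (2 * a + 1)) *: v
              - (c * (2 * a)) *: s).
  have -> : c + c * (2 * a + 1) = a^-1 by rewrite /c; field; lra.
  have -> : c - c * (2 * a + 1) = - (a + 1)^-1 by rewrite /c; field; lra.
  have -> : c * (2 * a) = (a + 1)^-1 by rewrite /c; field; lra.
  by rewrite scalerDr scaleNr opprD addrA.
rewrite scalerDr scalerA !scalerDr !scalerN scalerA !scalerDl scaleNr -!addrA.
congr (_ + _); rewrite addrCA; congr (_ + _).
by rewrite addrA addrC.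
Qed.

(** * Inequalities and identities for real powers *)

Lemma powR_weight (R : realType) (p a : R) : 0 < p -> 0 < a ->
  a `^ ((1 - p) / p) = a `^ p^-1 / a.
Proof.
move=> p0 a0; have -> : (1 - p) / p = p^-1 + -1 by field; lra.
by rewrite powRD ?powR_inv1 ?(ltW a0)// (gt_eqF a0) implybT.
Qed.

Lemma powR_root_mul (R : realType) (p a d : R) : 0 < p -> 0 <= a -> 0 <= d ->
  (a * d `^ p) `^ p^-1 = a `^ p^-1 * d.
Proof.
move=> p0 a0 d0; rewrite powRM ?powR_ge0// -powRrM divff ?powRr1//; lra.
Qed.

(* Dividing by [(2 * a) `^ p], this is [(1 + 1 / (2 * a)) `^ (p - 1) <= 2]. *)
Lemma powR_odd_bound (R : realType) (p a : R) : 1 < p -> p <= 2 -> 1 <= a ->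
  (2 * a) `^ p + a * (2 * a + 1) `^ p <= 2 * (a + 1) * (2 * a) `^ p.
Proof.
move=> p1 p2 a1; pose t := 1 + (2 * a)^-1.
have t1 : 1 <= t by rewrite lerDl invr_ge0; lra.
have t2 : t <= 2.
  have : (2 * a)^-1 <= 1 by rewrite invf_le1; lra.
  by rewrite /t; lra.
have -> : 2 * a + 1 = t * (2 * a) by rewrite /t; field; lra.
rewrite (powRM (x := t)); [|lra..].
have -> : t `^ p = t * t `^ (p - 1).
  by rewrite mulr_powRB1 ?subrKC; lra.
have : t `^ (p - 1) <= t by rewrite -[leRHS]powRr1 ?ler_powR; lra.
have -> : a * (t * t `^ (p - 1) * (2 * a) `^ p)
    = (a + 2^-1) * t `^ (p - 1) * (2 * a) `^ p by rewrite {1}/t; field; lra.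
have : 0 <= (2 * a) `^ p by exact: powR_ge0.
set W := (2 * a) `^ p; set q := t `^ _ => W0 qt.
rewrite -[X in X + _]mul1r -mulrDl ler_wpM2r//.
(* Since [q <= t <= 2], the left factor [1 + (a + 2^-1) * q] is at most [2 * (a + 1)]. *)
nra.
Qed.

(** * Pairing the points *)

Lemma codom_nth_ord (K : eqType) (x0 : K) (s : seq K) (k : nat) : size s = k ->
  codom (fun i : 'I_k => nth x0 s i) = s.
Proof.
move=> <-; rewrite -[RHS](mkseq_nth x0) /mkseq -val_enum_ord -map_comp.
by rewrite /codom /image_mem.
Qed.

(** Any pairing serves. Here the first half of the enumeration is matched with the next block of
    equal length, which leaves the last entry over when the cardinality is odd. *)
Lemma fset_split_pairs (R : realType) (X : normedModType R) (S : {fset X}) :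
  exists (f g : 'I_(#|` S|)./2 -> X) (r : seq X),
    perm_eq S ((codom f ++ codom g) ++ r) /\ size r = odd #|` S|.
Proof.
set n := #|` S|; pose s := enum_fset S.
have sn : size s = n by [].
have nE : n = (n./2 + n./2 + odd n)%N by lia.
exists (fun i => nth 0 (take n./2 s) i).
exists (fun i => nth 0 (take n./2 (drop n./2 s)) i).
exists (drop n./2 (drop n./2 s)); split; last by rewrite !size_drop sn; lia.
rewrite !codom_nth_ord ?size_takel ?size_drop ?sn; [|lia..].
by rewrite -catA !cat_take_drop.
Qed.

(** * The estimate for even and for odd [n] *)

Theorem theorem4 (R : realType) (X : completeNormedModType R) (p T : R)
    (hp1 : 1 < p) (hp2 : p <= 2) (hT : type_constant X p T)
    (n : nat) (hn : (2 <= n)%N) (S : {fset X}) (hS : #|` S| = n) :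
  let w := (1 - p) / p in
  let C := 2 `^ p^-1 * T in
  exists S1 S2 : {fset X},
    [/\ (S1 `|` S2)%fset = S,
        [disjoint S1 & S2]%fset,
        #|` S1| = n./2,
        #|` S2| = uphalf n &
        `|centroid S1 - centroid S2| <= C * (uphalf n)%:R `^ w * diam S].
Proof.
move=> w C.
(* Two distinct points give a nonzero vector, from which [0 <= T] follows. *)
have [x [y [xS yS xy]]] : exists x y, [/\ x \in S, y \in S & x != y].
  have : (1 < size S)%N by rewrite -[size S]/(#|` S|) hS.
  have mS z : (z \in S) = (z \in enum_fset S) by [].
  case: (enum_fset S) (fset_uniq S) mS => [|x [|y s]]//= /andP[xs _] mS _.
  exists x, y; rewrite !mS !inE !eqxx orbT; split => //.
  by move: xs; rewrite inE negb_or => /andP[].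
have p0 : 0 < p by lra.
have T0 : 0 <= T.
  by apply: (@type_constant_ge0 _ _ p T (x - y)); rewrite ?subr_eq0.
have D0 : 0 <= diam S by exact: le_trans (norm_sub_le_diam xS yS).
have [f [g [r [Sfg szr]]]] := fset_split_pairs S.
move: f g Sfg szr; rewrite hS; set k := n./2 => f g Sfg szr.
have k0 : (0 < k)%N by rewrite /k; lia.
have inS z : z \in (codom f ++ codom g) ++ r -> z \in S.
  by move=> zr; have := perm_mem Sfg z; rewrite zr.
have fS i : f i \in S by rewrite inS// !mem_cat codom_f.
have gS i : g i \in S by rewrite inS// !mem_cat codom_f orbT.
have rS z : z \in r -> z \in S by move=> zr; rewrite inS// mem_cat zr orbT.
have fg i : `|f i - g i| <= diam S by exact: norm_sub_le_diam.
have signE (b : 'I_k -> bool) :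
    \sum_i (if b i then g i else f i) - \sum_i (if b i then f i else g i)
    = \sum_i (-1) ^+ b i *: (f i - g i).
  rewrite -sumrB; apply: eq_bigr => i _.
  by case: (b i); rewrite ?scale1r// scaleN1r opprB.
have sumE (b : 'I_k -> bool) :
    \sum_i (if b i then g i else f i) + \sum_i (if b i then f i else g i)
    = \sum_i (f i + g i).
  rewrite -big_split; apply: eq_bigr => i _.
  by case: (b i) => //=; rewrite addrC.
have k0R : 0 < k%:R :> R by rewrite ltr0n.
have sumk (z : R) : k%:R * z = \sum_(i < k) z.
  by rewrite sumr_const card_ord mulr_natl.
have kE : uphalf n = (k + odd n)%N by rewrite /k uphalf_half addnC.
have [nodd|neven] := boolP (odd n); last first.
  rewrite (negbTE neven) in szr kE; move/size0nil: szr => r0.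
  rewrite {}r0 in Sfg inS rS.
  (* With head vector 0, whose [p]-th power vanishes, only the [k] differences contribute. *)
  have [b hb] := exists_signs_le_head 0 (fun i => f i - g i) hT.
  have [S1 [S2 [S12 dis c1 c2 cS]]] := swap_partition b Sfg.
  exists S1, S2; split => //; first by rewrite c2 kE.
  rewrite cS big_nil addr0 addn0 -scalerBr signE normrZ.
  rewrite ger0_norm ?invr_ge0 ?(ltW k0R)//.
  rewrite add0r in hb; rewrite kE addn0 powR_weight//.
  apply: (@le_trans _ _ (k%:R^-1 * (T * (k%:R `^ p^-1 * diam S)))).
    apply: ler_wpM2l; first by rewrite invr_ge0 ltW.
    apply: le_trans hb _; apply: ler_wpM2l => //.
    rewrite -powR_root_mul ?ler0n//.
    apply: ge0_ler_powR; rewrite ?nnegrE ?invr_ge0 ?(ltW p0)//.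
    - by rewrite addr_ge0 ?powR_ge0// sumr_ge0// => i _; exact: powR_ge0.
    - by rewrite mulr_ge0 ?powR_ge0 ?(ltW k0R).
    rewrite normr0 powR0 ?gt_eqF// add0r sumk.
    by apply: ler_sum => i _; apply: ge0_ler_powR; rewrite ?nnegrE ?(ltW p0).
  (* The even case holds even with [T] in place of [C]; the extra factor 2^(1/p) is at least 1. *)
  rewrite [leRHS](_ : _ = 2 `^ p^-1 *
      (k%:R^-1 * (T * (k%:R `^ p^-1 * diam S)))); last first.
    by rewrite /C; ring.
  apply: ler_peMl; last first.
    by rewrite -[X in X <= _](powRr0 2) ler_powR ?invr_ge0; lra.
  by rewrite !mulr_ge0 ?invr_ge0 ?powR_ge0// ltW.
rewrite nodd /= in szr kE.
case: r szr Sfg inS rS => [|s0 [|]]//= _ Sfg inS rS.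
have s0S : s0 \in S by rewrite rS ?mem_seq1.
set K : R := k%:R in k0R sumk *.
have K1 : 1 <= K by rewrite ler1n.
(* The multiple [2 * K] of [s0] is spread over the [2 * k] paired points, giving as many differences
   of norm at most [diam S]. *)
have Q0 : `|\sum_i (f i + g i) - (2 * K) *: s0| <= 2 * K * diam S.
  rewrite [X in `|X|](_ : _ = \sum_i ((f i - s0) + (g i - s0))).
    apply: le_trans (ler_norm_sum _ _ _) _.
    rewrite [2 * K]mulrC -mulrA sumk.
    apply: ler_sum => i _; apply: le_trans (ler_normD _ _) _.
    by rewrite mulr_natl mulr2n lerD// norm_sub_le_diam.
  under [RHS]eq_bigr do rewrite addrACA -opprD.
  rewrite sumrB sumr_const card_ord -mulr2n -mulrnA -[_ *+ (2 * k)]scaler_nat.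
  by rewrite natrM.
have [b hb] := exists_signs_le_head (\sum_i (f i + g i) - (2 * K) *: s0)
  (fun i => (2 * K + 1) *: (f i - g i)) hT.
have [S1 [S2 [S12 dis c1 c2 cS]]] := swap_partition b Sfg.
exists S1, S2; split => //; first by rewrite c2 kE.
rewrite cS kE /= big_seq1 natrD -/K centroid_sub_odd//.
rewrite signE sumE normrZ ger0_norm ?invr_ge0 ?mulr_ge0; [|lra..].
rewrite scaler_sumr.
under [X in _ * `|_ + X|]eq_bigr do rewrite scalerA mulrC -scalerA.
rewrite powR_weight; [|lra..].
(* By [powR_odd_bound], the sum of the [p]-th powers of the [k + 1] norms is at most [2 * (K + 1)]
   times the [p]-th power of [2 * K * diam S]. *)
apply: (@le_trans _ _ ((2 * K * (K + 1))^-1 *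
    (T * ((2 * (K + 1)) `^ p^-1 * (2 * K * diam S))))).
  apply: ler_wpM2l; first by rewrite invr_ge0 !mulr_ge0//; lra.
  apply: le_trans hb _; apply: ler_wpM2l => //.
  have KD : 0 <= 2 * K * diam S by rewrite !mulr_ge0//; lra.
  rewrite -powR_root_mul//; last lra.
  apply: ge0_ler_powR; rewrite ?nnegrE ?invr_ge0 ?(ltW p0)//.
  - by rewrite addr_ge0 ?powR_ge0// sumr_ge0// => i _; exact: powR_ge0.
  - by rewrite mulr_ge0 ?powR_ge0//; lra.
  apply: (@le_trans _ _
      ((2 * K * diam S) `^ p + K * ((2 * K + 1) * diam S) `^ p)).
    apply: lerD; first by apply: ge0_ler_powR; rewrite ?nnegrE ?(ltW p0).
    rewrite sumk.
    apply: ler_sum => i _; apply: ge0_ler_powR; rewrite ?nnegrE ?(ltW p0)//.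
    - by rewrite mulr_ge0//; lra.
    - by rewrite normrZ ger0_norm ?ler_wpM2l//; lra.
  rewrite !(powRM (y := diam S)) ?mulrA -?mulrDl; [|lra..].
  by rewrite ler_wpM2r ?powR_ge0 ?powR_odd_bound.
(* The factor [2 * K] cancels, 2^(1/p) goes into [C], and (K + 1)^(1/p) / (K + 1) is the required
   power of [K + 1]. *)
rewrite powRM; [|lra..].
rewrite /C le_eqVlt; apply/orP; left; apply/eqP; field; lra.
Qed.
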